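(* Let $\mu_0$ and $\pi$ be probability distributions on $\mathbb{R}^d$ with densities with respect to Lebesgue measure (denoted by the same letters), let $T\ge 1$, and let $0=\lambda_0<\lambda_1<\dots<\lambda_T=1$. Let $(\mu_n)_{n=1}^T$ be the tempering sequence $$\mu_{n}\propto \mu_0^{1-\lambda_{n}}\,\pi^{\lambda_{n}},\qquad 1\le n\le T .$$ Then for every $1\le n\le T$, $$\mathrm{KL}(\mu_n|\pi)\le \frac{1-\lambda_n}{\lambda_1}\,\mathrm{KL}(\pi|\mu_0).$$
   Context: For probability measures $\nu,\mu$ on $\mathbb{R}^d$, $\mathrm{KL}(\nu|\mu)=\int\log\left(\frac{d\nu}{d\mu}\right)d\nu$ if $\nu$ is absolutely continuous with respect to $\mu$, and $+\infty$ otherwise. The symbol $\propto$ means equality up to the positive normalizing constant making the left-hand side a probability density; it is assumed that these normalizing constants are positive, so that the sequence is well defined. Conventions: $0^0=1$ (so $\mu_T=\pi$) and $0\cdot(+\infty)=0$. *)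

(* Defs.v *)
From HB Require Import structures.
From mathcomp Require Import all_boot all_order all_algebra.
From mathcomp Require Import all_classical all_reals all_analysis.

Set Implicit Arguments.
Unset Strict Implicit.
Unset Printing Implicit Defensive.

Import Order.TTheory GRing.Theory Num.Theory.
Import numFieldNormedType.Exports.

Local Open Scope classical_set_scope.
Local Open Scope ring_scope.
Local Open Scope ereal_scope.

(* R^d, with the product of the Borel sigma-algebras of R. *)
Notation euclidean R d := (d.-tuple (measurableTypeR R)).

Section tuple_cons.
Context {R : realType} (d : nat).

Definition tuple_cons (p : measurableTypeR R * euclidean R d) :
  euclidean R d.+1 := [the d.+1.-tuple (measurableTypeR R) of p.1 :: p.2].

Definition tuple_uncons (x : euclidean R d.+1) :
  measurableTypeR R * euclidean R d := (thead x, [tuple of behead x]).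

Lemma tuple_consK : cancel tuple_cons tuple_uncons.
Proof.
by case=> a t; rewrite /tuple_uncons theadE; congr pair; exact/val_inj.
Qed.

Lemma measurable_tuple_cons : measurable_fun setT tuple_cons.
Proof. exact: measurable_cons. Qed.

Lemma measurable_tuple_uncons : measurable_fun setT tuple_uncons.
Proof.
apply: measurable_fun_pair; first exact: measurable_tnth.
exact: measurable_behead.
Qed.

HB.instance Definition _ :=
  isMeasurableFun.Build _ _ _ _ tuple_cons measurable_tuple_cons.

Variable mu : {sigma_finite_measure set (euclidean R d) -> \bar R}.

Definition lebesgue_cons : set (euclidean R d.+1) -> \bar R :=
  pushforward (lebesgue_measure \x mu) tuple_cons.

Let lebesgue_cons0 : lebesgue_cons set0 = 0.
Proof. exact: measure0. Qed.

Let lebesgue_cons_ge0 A : 0 <= lebesgue_cons A.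
Proof. exact: measure_ge0. Qed.

Let lebesgue_cons_sigma_additive : semi_sigma_additive lebesgue_cons.
Proof. exact: measure_semi_sigma_additive. Qed.

HB.instance Definition _ := isMeasure.Build _ _ _ lebesgue_cons
  lebesgue_cons0 lebesgue_cons_ge0 lebesgue_cons_sigma_additive.

Let lebesgue_cons_sigma_finite : sigma_finite setT lebesgue_cons.
Proof.
have /sigma_finiteP[F [FT ndF Foo]] := sigma_finiteT (@lebesgue_measure R).
have /sigma_finiteP[G [GT ndG Goo]] := sigma_finiteT mu.
exists (fun i => tuple_uncons @^-1` (F i `*` G i)).
  rewrite -preimage_bigcup; apply/seteqP; split=> // x _ /=.
  have [i _ Fi] : (\bigcup_i F i) (tuple_uncons x).1 by rewrite -FT.
  have [j _ Gj] : (\bigcup_i G i) (tuple_uncons x).2 by rewrite -GT.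
  exists (maxn i j) => //; split.
    by move: Fi; exact/subsetPset/ndF/leq_maxl.
  by move: Gj; exact/subsetPset/ndG/leq_maxr.
move=> i; have [mF lF] := Foo i; have [mG lG] := Goo i.
split.
  rewrite -[X in measurable X]setTI; apply: measurable_tuple_uncons => //.
  exact: measurableX.
rewrite /lebesgue_cons /pushforward -comp_preimage.
rewrite (_ : _ \o _ = id); last by apply/funext => p /=; rewrite tuple_consK.
by rewrite preimage_id product_measure1E// lte_mul_pinfty// ge0_fin_numE.
Qed.

HB.instance Definition _ := Measure_isSigmaFinite.Build _ _ _ lebesgue_cons
  lebesgue_cons_sigma_finite.

End tuple_cons.

(* On the one-point space R^0 the Lebesgue measure is the unit mass. *)
Fixpoint lebesgue_measure_n (R : realType) (d : nat) :
    {sigma_finite_measure set (euclidean R d) -> \bar R} :=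
  if d is d'.+1 then lebesgue_cons (lebesgue_measure_n R d')
  else dirac ([tuple] : euclidean R 0).

Lemma lebesgue_measure_n_box (R : realType) (d : nat)
    (A : 'I_d -> set (measurableTypeR R)) : (forall i, measurable (A i)) ->
  lebesgue_measure_n R d [set x | forall i, A i (tnth x i)] =
  \prod_(i < d) lebesgue_measure (A i).
Proof.
elim: d A => [|d IHd] A mA.
  rewrite big_ord0 /= /dirac/= indicE mem_set//=; by case.
rewrite big_ord_recl -(IHd (fun i => A (lift ord0 i)))//=.
rewrite /lebesgue_cons /pushforward.
rewrite -product_measure1E//=; last first.
  rewrite (_ : [set x | _] =
    \bigcap_i ((fun x : euclidean R d => tnth x i) @^-1` A (lift ord0 i))).
    apply: fin_bigcap_measurable => // i _.
    by rewrite -[X in measurable X]setTI; exact: measurable_tnth.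
  by apply/seteqP; split=> x /= h i; [move=> _|]; exact: h.
congr (product_measure1 _ _); apply/seteqP; split=> -[a t] /=.
  move=> h; split; first exact: (h ord0).
  by move=> i; have := h (lift ord0 i); rewrite tnthS.
by move=> [ha ht] i; case: (unliftP ord0 i) => [j|] ->; rewrite ?tnthS.
Qed.

Section density.
Context {R : realType} {d : nat}.
Implicit Types (P : probability (euclidean R d) R) (f w : euclidean R d -> R).

Definition has_density P f :=
  [/\ measurable_fun setT f, forall x, (0 <= f x)%R &
      forall A, measurable A ->
        P A = \int[lebesgue_measure_n R d]_(x in A) (f x)%:E].

(* As P has total mass 1, the constant c is necessarily the integral of w. *)
Definition has_density_propto P w :=
  exists2 c : R, (0 < c)%R & has_density P (fun x => w x / c)%R.

End density.

Section KL.
Context {dT : measure_display} {T : measurableType dT} {R : realType}.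
Local Open Scope charge_scope.

(* lne 0 = -oo, but 'd nu '/d mu is positive nu-almost everywhere. *)
Definition KL (nu mu : probability T R) : \bar R :=
  if `[< nu `<< mu >] then
    \int[nu]_x lne (('d (charge_of_finite_measure nu) '/d mu) x)
  else +oo.

End KL.

(* Main.v *)
(* Let c be the normalizing constant of mu_n, i.e. the integral of
   f^(1 - lam_n) g^lam_n. Nonnegativity of KL(mu_n | mu_0) turns into
   KL(mu_n | pi) <= - ln c / lam_n, and Jensen's inequality for ln under pi gives
   - ln c <= (1 - lam_n) KL(pi | mu_0); finally lam_1 <= lam_n. Both inequalities
   are obtained by integrating the tangent bound ln x <= x - 1 pointwise, applied
   to a ratio of densities whose integral is at most 1, so that the logarithms
   never have to be integrable. *)
Require Import Defs.
From mathcomp Require Import all_boot all_order all_algebra.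
From mathcomp Require Import all_classical all_reals all_analysis.
From mathcomp Require Import measurable_realfun ring lra.
Set Implicit Arguments.
Unset Strict Implicit.
Unset Printing Implicit Defensive.
Import Order.TTheory GRing.Theory Num.Theory.
Local Open Scope ring_scope.

(** * Tangent bound for the logarithm; measurability and comparison of integrals *)

Lemma ln_le_subr1 (R : realType) (x : R) : 0 < x -> ln x <= x - 1.
Proof. by move=> x0; rewrite -[in ln x](subrKC 1 x) le_ln1Dx//; lra. Qed.

Section integration.
Local Open Scope classical_set_scope.
Local Open Scope ereal_scope.
Context {dT : measure_display} {T : measurableType dT} {R : realType}.

Lemma measurable_lne : measurable_fun [set: \bar R] (@lne R).
Proof.
rewrite (_ : @lne R = fun x => if x <= 0 then -oo else
  if x == +oo then +oo else (ln (fine x))%:E); last first.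
  by apply/funext => -[r| |]; rewrite ?leNye//= lee_fin.
apply: measurable_fun_ifT => //=; first exact: measurable_fun_lee.
apply: measurable_fun_ifT => //=; first exact: measurable_fun_eqe.
apply/measurable_EFinP; apply: measurableT_comp => //; exact: measurable_ln.
Qed.

Lemma measurable_fun_div_ge0 (f g : T -> R) : (forall x, (0 <= g x)%R) ->
  measurable_fun setT f -> measurable_fun setT g ->
  measurable_fun setT (fun x => f x / g x)%R.
Proof.
move=> g0 mf mg.
rewrite (_ : (fun _ => _) = (fun x => f x * (g x `^ (-1)))%R); last first.
  by apply/funext => x; rewrite powR_inv1.
apply: measurable_funM => //.
exact: (@measurableT_comp _ _ _ _ _ _ (@powR R ^~ (-1)%R)).
Qed.

(* No integrability is needed: the positive and the negative parts are compared
   separately. *)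
Lemma ae_le_integral (m : {measure set T -> \bar R}) (f g : T -> \bar R) :
  measurable_fun setT f -> measurable_fun setT g ->
  {ae m, forall x, f x <= g x} -> \int[m]_x f x <= \int[m]_x g x.
Proof.
move=> mf mg fg; rewrite integralE [leRHS]integralE; apply: leeB.
  apply: ae_ge0_le_integral => //; [exact: measurable_funepos..|].
  by apply: filterS fg => x fgx _; apply: (@funepos_le _ _ [set x]);
    rewrite ?inE// => _ /set_mem ->.
apply: ae_ge0_le_integral => //; [exact: measurable_funeneg..|].
by apply: filterS fg => x fgx _; apply: (@funeneg_le _ _ [set x]);
  rewrite ?inE// => _ /set_mem ->.
Qed.

End integration.

(** * Measures with densities: change of variables, domination, divergence *)

Section density_theory.
Local Open Scope classical_set_scope.
Local Open Scope ereal_scope.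
Local Open Scope charge_scope.
Context {R : realType} {d : nat}.
Local Notation leb := (lebesgue_measure_n R d).
Implicit Types (P Q : probability (euclidean R d) R) (a b : euclidean R d -> R).

(** On [E], [a] agrees almost everywhere with the Radon-Nikodym derivative of [P] with respect to
    [leb], since both have the same integrals over measurable subsets. *)
Lemma has_density_integral P a (F : euclidean R d -> \bar R) E :
  has_density P a -> (forall x, 0 <= F x) -> measurable E ->
  measurable_fun E F ->
  \int[P]_(x in E) F x = \int[leb]_(x in E) (F x * (a x)%:E).
Proof.
move=> [ma a0 Pa] F0 mE mF.
have Pleb : P `<< leb.
  apply/null_content_dominatesP => A mA A0.
  rewrite [LHS]Pa//; apply: null_set_integral => //.
  exact/measurable_EFinP/measurable_funTS.
have fa : ae_eq leb E (Radon_Nikodym_SigmaFinite.f P leb) (EFin \o a).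
  apply: integral_ae_eq => //.
  - exact: integrableS (Radon_Nikodym_SigmaFinite.f_integrable Pleb).
  - exact/measurable_EFinP/measurable_funTS.
  - move=> A AE mA; rewrite -Radon_Nikodym_SigmaFinite.f_integral//.
    exact: Pa.
rewrite -(Radon_Nikodym_SigmaFinite.change_of_variables Pleb)//.
apply: ae_eq_integral => //.
- apply: emeasurable_funM => //; apply: measurable_funTS.
  exact: measurable_int (Radon_Nikodym_SigmaFinite.f_integrable Pleb).
- apply: emeasurable_funM => //.
  exact/measurable_EFinP/measurable_funTS.
- exact: ae_eqe_mul2l.
Qed.

Lemma has_density_gt0 P a : has_density P a -> {ae P, forall x, (0 < a x)%R}.
Proof.
move=> [ma a0 Pa]; exists [set x | (a x <= 0)%R]; split.
- by rewrite -[X in measurable X]setTI; apply: measurable_fun_le.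
- rewrite [LHS]Pa; last first.
    by rewrite -[X in measurable X]setTI; apply: measurable_fun_le.
  apply: integral0_eq => x /= ax0; congr _%:E; apply/eqP.
  by rewrite eq_le ax0 a0.
- by move=> x /= /negP; rewrite -leNgt.
Qed.

(** By the inclusion of zero sets, [a = a / b * b] everywhere, so [P A] is the [Q]-integral of
    [a / b] over [A]. *)
Lemma has_density_dominates P Q a b : has_density P a -> has_density Q b ->
  (forall x, b x = 0%R -> a x = 0%R) -> P `<< Q.
Proof.
move=> Pa Qb ba; have [ma a0 PE] := Pa; have [mb b0 QE] := Qb.
apply/null_content_dominatesP => A mA QA0; rewrite [LHS]PE//.
have mab := measurable_fun_div_ge0 b0 ma mb.
rewrite -(@null_set_integral _ _ _ Q A (fun x => (a x / b x)%:E))//; last first.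
  exact/measurable_EFinP/measurable_funTS.
rewrite (has_density_integral Qb)//.
- apply: eq_integral => x _; rewrite -EFinM; congr _%:E.
  have [bx0|bx0] := eqVneq (b x) 0%R; first by rewrite ba// bx0 mulr0.
  by rewrite divfK.
- by move=> x; rewrite lee_fin divr_ge0.
- exact/measurable_EFinP/measurable_funTS.
Qed.

Lemma Radon_Nikodym_density P Q a b : has_density P a -> has_density Q b ->
  P `<< Q ->
  ae_eq Q setT ('d (charge_of_finite_measure P) '/d Q)
               (fun x => (a x / b x)%:E).
Proof.
move=> Pa Qb PQ; have [ma a0 PE] := Pa; have [mb b0 QE] := Qb.
have mab := measurable_fun_div_ge0 b0 ma mb.
apply: integral_ae_eq => //.
- exact: Radon_Nikodym_integrable.
- exact/measurable_EFinP.
- move=> E _ mE; rewrite -Radon_Nikodym_integral//=.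
  rewrite (has_density_integral Qb)//; last 2 first.
  + by move=> x; rewrite lee_fin divr_ge0.
  + exact/measurable_EFinP/measurable_funTS.
  have mB : measurable [set x | (0 < b x)%R].
    rewrite (_ : mkset _ = ~` [set x | (b x <= 0)%R]).
      apply: measurableC; rewrite -[X in measurable X]setTI.
      exact: measurable_fun_le.
    by apply/seteqP; split => x /=; rewrite ltNge => /negP.
  (* The integral of [a / b * b] only sees the part of [E] where [b > 0]; the rest is [Q]-null,
     hence [P]-null. *)
  transitivity (P (E `&` [set x | (0 < b x)%R])).
    rewrite (measureDI P mE mB).
    rewrite [X in X + _](_ : _ = 0) ?add0e//.
    have /null_content_dominatesP := PQ; apply; first exact: measurableD.
    have [N [mN N0 bN]] := has_density_gt0 Qb.
    apply: (subset_measure0 _ mN _ N0); first exact: measurableD.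
    by move=> x [_ /= bx]; exact: bN.
  rewrite [LHS]PE; last exact: measurableI.
  rewrite integral_mkcondr; apply: eq_integral => x _.
  rewrite patchE; case: ifPn => [/set_mem/= bx|].
    by rewrite -EFinM divfK// gt_eqF.
  rewrite notin_setE/= => /negP; rewrite -leNgt => bx.
  have -> : b x = 0%R by apply/eqP; rewrite eq_le bx b0.
  by rewrite mule0.
Qed.

Lemma dominates_density_gt0 P Q b : has_density Q b -> P `<< Q ->
  {ae P, forall x, (0 < b x)%R}.
Proof.
move=> Qb /null_content_dominatesP PQ.
by have [N [mN N0 bN]] := has_density_gt0 Qb; exists N; split => //; exact: PQ.
Qed.

(** [lne] and [ln] differ at 0, so positivity of both densities [P]-almost everywhere is used;
    domination carries the [Q]-almost everywhere formula for the derivative over to [P]. *)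
Lemma KL_density P Q a b : has_density P a -> has_density Q b -> P `<< Q ->
  KL P Q = \int[P]_x (ln (a x / b x))%:E.
Proof.
move=> Pa Qb PQ; have [ma a0 PE] := Pa; have [mb b0 QE] := Qb.
rewrite /KL asboolT//; apply: ae_eq_integral => //.
- apply: measurableT_comp; first exact: measurable_lne.
  by apply: measurable_int; apply: Radon_Nikodym_integrable.
- apply/measurable_EFinP; apply: measurableT_comp; first exact: measurable_ln.
  exact: measurable_fun_div_ge0.
- have RN :=
    null_dominates_ae_eq measurableT PQ (Radon_Nikodym_density Pa Qb PQ).
  apply: filterS3 RN (dominates_density_gt0 Qb PQ) (has_density_gt0 Pa) => x RNx bx ax _.
  by rewrite RNx// lne_EFin// divr_gt0.
Qed.

(** [b / a * a] is [b] where [a] is nonzero and 0 elsewhere, so any [Q]-mass on the zero set of [a]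
    is lost. *)
Lemma integral_density_ratio_le1 P Q a b : has_density P a -> has_density Q b ->
  \int[P]_x (b x / a x)%:E <= 1.
Proof.
move=> Pa Qb; have [ma a0 PE] := Pa; have [mb b0 QE] := Qb.
have mba := measurable_fun_div_ge0 a0 mb ma.
rewrite (has_density_integral Pa)//; last 2 first.
- by move=> x; rewrite lee_fin divr_ge0.
- exact/measurable_EFinP.
rewrite -(probability_setT Q) QE//; apply: ge0_le_integral => //.
- by move=> x _; rewrite -EFinM lee_fin mulr_ge0// divr_ge0.
- by apply: emeasurable_funM; exact/measurable_EFinP.
- exact/measurable_EFinP.
- move=> x _; rewrite -EFinM lee_fin.
  have [->|ax0] := eqVneq (a x) 0%R; first by rewrite mulr0.
  by rewrite divfK.
Qed.

(** The bound by 1 makes the ratio integrable, so [k] may have either sign; both signs occur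
    below. *)
Lemma integral_density_ratio_affine P Q a b (k l : R) :
  has_density P a -> has_density Q b ->
  \int[P]_x (k * (b x / a x) + l)%:E =
  k%:E * \int[P]_x (b x / a x)%:E + l%:E.
Proof.
move=> Pa Qb; have [ma a0 _] := Pa; have [mb b0 _] := Qb.
have iba : P.-integrable setT (fun x => (b x / a x)%:E).
  apply/integrableP; split.
    exact/measurable_EFinP/measurable_fun_div_ge0.
  under eq_integral do rewrite gee0_abs ?lee_fin ?divr_ge0//.
  by apply: le_lt_trans (integral_density_ratio_le1 Pa Qb) (ltry _).
under eq_integral do rewrite EFinD EFinM.
rewrite integralD//; first last.
- exact: finite_measure_integrable_cst.
- exact: integrableZl.
by rewrite integralZl// integral_cst// [X in _ + _ * X](probability_setT P) mule1.
Qed.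

(** Turns a pointwise tangent bound into a bound on [KL]: [h / a] has [P]-integral at most 1, and
    [0 <= k] lets 1 replace that integral. *)
Lemma KL_le_affine P Q M a b h (k l : R) :
  has_density P a -> has_density Q b -> has_density M h -> P `<< Q ->
  (0 <= k)%R ->
  (forall x, 0 < a x -> 0 < b x -> ln (a x / b x) <= k * (h x / a x) + l)%R ->
  KL P Q <= (k + l)%:E.
Proof.
move=> Pa Qb Mh PQ k0 abkl; have [ma a0 _] := Pa; have [mb b0 _] := Qb.
have [mh h0 _] := Mh.
rewrite (KL_density Pa Qb PQ).
apply: (@le_trans _ _ (\int[P]_x (k * (h x / a x) + l)%:E)).
  apply: ae_le_integral.
  - apply/measurable_EFinP; apply: measurableT_comp; first exact: measurable_ln.
    exact: measurable_fun_div_ge0.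
  - apply/measurable_EFinP; apply: measurable_funD => //.
    by apply: measurable_funM => //; exact: measurable_fun_div_ge0.
  - apply: filterS2 (dominates_density_gt0 Qb PQ) (has_density_gt0 Pa) => x bx ax.
    by rewrite lee_fin abkl.
rewrite (integral_density_ratio_affine _ _ Pa Mh) EFinD leeD2r//.
rewrite -[leRHS]mule1 lee_wpmul2l// ?lee_fin//.
exact: integral_density_ratio_le1 Pa Mh.
Qed.

(** Mirror image with slope [- k]; without domination [KL] is [+oo] and the bound is immediate. *)
Lemma KL_ge_affine P Q M a b h (k l : R) :
  has_density P a -> has_density Q b -> has_density M h -> (0 <= k)%R ->
  (forall x, 0 < a x -> 0 < b x -> l - k * (h x / a x) <= ln (a x / b x))%R ->
  (l - k)%:E <= KL P Q.
Proof.
move=> Pa Qb Mh k0 abkl; have [ma a0 _] := Pa; have [mb b0 _] := Qb.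
have [mh h0 _] := Mh.
have [PQ|PQ] := pselect (P `<< Q); last by rewrite /KL asboolF// leey.
rewrite (KL_density Pa Qb PQ).
apply: (@le_trans _ _ (\int[P]_x (- k * (h x / a x) + l)%:E)).
  rewrite (integral_density_ratio_affine _ _ Pa Mh) addrC EFinD leeD2r//.
  rewrite -[leLHS]mule1 !EFinN !mulNe leeN2 lee_wpmul2l// ?lee_fin//.
  exact: integral_density_ratio_le1 Pa Mh.
apply: ae_le_integral.
- apply/measurable_EFinP; apply: measurable_funD => //.
  by apply: measurable_funM => //; exact: measurable_fun_div_ge0.
- apply/measurable_EFinP; apply: measurableT_comp; first exact: measurable_ln.
  exact: measurable_fun_div_ge0.
- apply: filterS2 (dominates_density_gt0 Qb PQ) (has_density_gt0 Pa) => x bx ax.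
  by rewrite lee_fin mulNr addrC abkl.
Qed.

(** Gibbs' inequality: the tangent bound at [b / a], with [k = l = 1]. *)
Lemma KL_ge0 P Q a b : has_density P a -> has_density Q b -> 0 <= KL P Q.
Proof.
move=> Pa Qb; rewrite -[leLHS]/(0%R%:E) -(subrr 1%R).
apply: (KL_ge_affine Pa Qb Qb) => // x ax bx.
have := @ln_le_subr1 R (b x / a x); rewrite divr_gt0// => /(_ isT).
by rewrite !ln_div ?posrE//; lra.
Qed.

End density_theory.

(** * Divergences of a tempered density *)

Section tempering.
Context {R : realType} {d : nat}.
Implicit Types (mu pi P : probability (euclidean R d) R).
Implicit Types (f g : euclidean R d -> R) (t c : R).

Lemma ln_tempering f g t c x : 0 < f x -> 0 < g x -> 0 < c ->
  ln (f x `^ (1 - t) * g x `^ t / c) =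
  (1 - t) * ln (f x) + t * ln (g x) - ln c.
Proof.
move=> fx gx c0.
by rewrite ln_div ?lnM ?posrE ?mulr_gt0 ?powR_gt0// !ln_powR.
Qed.

(** With [w] the density of [P] and [k = (1 - t) / t], [ln (w / g) = k * ln (f / w) - ln c / t]; the
    tangent bound is applied at [f / w]. *)
Lemma KL_tempering_le mu pi P f g t c :
  has_density mu f -> has_density pi g -> 0 < t < 1 -> 0 < c ->
  has_density P (fun x => f x `^ (1 - t) * g x `^ t / c) ->
  (KL P pi <= (- (ln c / t))%:E)%E.
Proof.
move=> mf pg /andP[t0 t1] c0 Pw; have [_ f0 _] := mf; have [_ g0 _] := pg.
pose k : R := (1 - t) / t.
have k0 : 0 <= k by rewrite divr_ge0 ?subr_ge0 // ltW.
have -> : - (ln c / t) = k + (- k - k * ln c - ln c).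
  by rewrite /k; field; exact: lt0r_neq0.
have tN0 : t != 0 by rewrite gt_eqF.
apply: (KL_le_affine Pw pg mf) => //.
  (* Since [t] is nonzero, 0 to the power [t] is 0: the tempered density vanishes wherever [g]
     does. *)
  apply: (has_density_dominates Pw pg) => x gx0.
  by rewrite gx0 powR0 ?mulr0 ?mul0r.
move=> x wx gx.
(* Since [t < 1], a zero of [f] would likewise make the tempered density vanish. *)
have fx : 0 < f x.
  rewrite lt_neqAle f0 andbT; apply/eqP => fx0; move: wx.
  by rewrite -fx0 powR0 ?mul0r ?ltxx// subr_eq0 gt_eqF.
have := ln_tempering t fx gx c0; move: wx => /=.
move: (_ / c) => w w0 lw.
have := @ln_le_subr1 R (f x / w); rewrite divr_gt0// => /(_ isT).
rewrite !ln_div ?posrE// lw.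
set r := (f x / w); move: (ln (f x)) (ln (g x)) (ln c) => u v s H.
rewrite -(ler_pM2l t0).
have -> : t * (k * r + (- k - k * s - s)) = (1 - t) * (r - 1 - s) - t * s.
  by rewrite /k; field.
(* The tangent bound [H], simplified and multiplied by [1 - t]; the goal is then linear in the
   monomials. *)
have : (1 - t) * (t * (u - v) + s) <= (1 - t) * (r - 1).
  by rewrite ler_wpM2l ?subr_ge0 ?(ltW t1)//; lra.
lra.
Qed.

(** Jensen's inequality in tangent form: with [w] the density of [P], [(1 - t) * ln (g / f) = - ln c
    - ln (w / g)], and [ln (w / g) <= w / g - 1]. *)
Lemma KL_tempering_ge mu pi P f g t c :
  has_density mu f -> has_density pi g -> t < 1 -> 0 < c ->
  has_density P (fun x => f x `^ (1 - t) * g x `^ t / c) ->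
  ((- (ln c / (1 - t)))%:E <= KL pi mu)%E.
Proof.
move=> mf pg t1 c0 Pw; have [_ f0 _] := mf; have [_ g0 _] := pg.
have t10 : 0 < 1 - t by rewrite subr_gt0.
have t1N0 : 1 - t != 0 by rewrite gt_eqF.
have -> : - (ln c / (1 - t)) = (1 - ln c) / (1 - t) - (1 - t)^-1 by field.
apply: (KL_ge_affine pg mf Pw); first by rewrite invr_ge0 ltW.
move=> x gx fx.
have : 0 < f x `^ (1 - t) * g x `^ t / c.
  by rewrite divr_gt0 ?mulr_gt0 ?powR_gt0.
have /= := ln_tempering t fx gx c0; move: (_ / c) => w lw w0.
have := @ln_le_subr1 R (w / g x); rewrite divr_gt0// => /(_ isT).
rewrite !ln_div ?posrE// lw.
set r := (w / g x); move: (ln (f x)) (ln (g x)) (ln c) => u v s H.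
rewrite -(ler_pM2l t10).
have -> : (1 - t) * ((1 - s) / (1 - t) - (1 - t)^-1 * r) = 1 - s - r by field.
lra.
Qed.

(** The endpoint [t = 1], excluded from [KL_tempering_le]: equal total masses force [c = 1], and the
    logarithm of the ratio is 0. *)
Lemma KL_proportional_le0 pi P g c : has_density pi g -> 0 < c ->
  has_density P (fun x => g x / c) -> (KL P pi <= 0)%E.
Proof.
move=> pg c0 Pg; have [_ g0 _] := pg.
have c1 : c = 1.
  have [mgc gc0 PE] := Pg; have [mg _ pE] := pg.
  have := probability_setT P; rewrite PE//.
  under eq_integral do rewrite EFinM.
  rewrite ge0_integralZr// -?pE// ?lee_fin ?invr_ge0 ?ltW//; last 2 first.
  - exact/measurable_EFinP.
  - by move=> x _; rewrite lee_fin.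
  rewrite probability_setT mul1e => -[] /(congr1 GRing.inv).
  by rewrite invrK invr1.
rewrite -[leRHS]adde0; apply: (KL_le_affine Pg pg pg) => //.
  by apply: (has_density_dominates Pg pg) => x ->; rewrite mul0r.
by move=> x _ gx; rewrite c1 divr1 divff ?gt_eqF// ln1 mul0r addr0.
Qed.

End tempering.

(* mu 0 is the initial distribution, with density f; pi has density g;
   powR satisfies 0 `^ 0 = 1, and 0 * +oo = 0 in \bar R. *)
Theorem mainTheorem3 (R : realType) (d T : nat)
    (mu : nat -> probability (euclidean R d) R)
    (pi : probability (euclidean R d) R)
    (f g : euclidean R d -> R) (lam : nat -> R)
    (f_dens : has_density (mu 0%N) f)
    (g_dens : has_density pi g)
    (T_ge1 : (1 <= T)%N)
    (lam0 : lam 0%N = 0)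
    (lam_lt : forall i : nat, (i < T)%N -> lam i < lam i.+1)
    (lamT : lam T = 1)
    (mu_tempering : forall n : nat, (1 <= n <= T)%N ->
      has_density_propto (mu n)
        (fun x => f x `^ (1 - lam n) * g x `^ lam n)) :
  forall n : nat, (1 <= n <= T)%N ->
    (KL (mu n) pi <= ((1 - lam n) / lam 1%N)%:E * KL pi (mu 0%N))%E.
Proof.
have lam_le i j : (i <= j <= T)%N -> lam i <= lam j.
  elim: j => [|j IHj] /andP[]; first by rewrite leqn0 => /eqP ->.
  rewrite leq_eqVlt => /predU1P[->//|ij jT].
  apply: (le_trans (IHj _)); last exact/ltW/lam_lt.
  by rewrite -ltnS ij ltnW.
move=> n /[dup] /andP[n1 nT] /mu_tempering[c c0 mun].
have lam1_gt0 : 0 < lam 1%N by rewrite -lam0; exact: lam_lt.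
have lam1n : lam 1%N <= lam n by rewrite lam_le// n1.
have lamn_gt0 : 0 < lam n by exact: lt_le_trans lam1n.
have KL_nneg := KL_ge0 g_dens f_dens.
(* If [lam n = 1] the right-hand side is 0, even when the divergence is [+oo]; otherwise division by
   [1 - lam n] is legitimate. *)
have [lamn1|lamn1] := eqVneq (lam n) 1.
  rewrite lamn1 subrr mul0r mul0e; apply: (KL_proportional_le0 g_dens c0).
  move: mun; congr (has_density (mu n)); apply/funext => x.
  by have [_ g0 _] := g_dens; rewrite lamn1 subrr powRr0 mul1r powRr1.
have lamn_lt1 : lam n < 1.
  by rewrite lt_neqAle lamn1 -lamT lam_le// nT leqnn.
have lamn01 : 0 < lam n < 1 by rewrite lamn_gt0.
apply: (le_trans (KL_tempering_le f_dens g_dens lamn01 c0 mun)).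
(* The sharper factor with [lam n] in the denominator is proved; [KL_nneg] lets the comparison of
   factors pass through a possibly infinite divergence. *)
apply: (@le_trans _ _ (((1 - lam n) / lam n)%:E * KL pi (mu 0%N))%E); last first.
  rewrite lee_wpmul2r// lee_fin ler_wpM2l ?subr_ge0 ?(ltW lamn_lt1)//.
  by rewrite lef_pV2 ?posrE.
(* Isolates the lower bound of [KL_tempering_ge] behind a nonnegative factor. *)
have -> : - (ln c / lam n) = (1 - lam n) / lam n * - (ln c / (1 - lam n)).
  by field; rewrite subr_eq0 eq_sym lamn1 gt_eqF.
rewrite EFinM; apply: lee_wpmul2l.
  by rewrite lee_fin divr_ge0 ?subr_ge0 ?ltW.
exact: KL_tempering_ge f_dens g_dens lamn_lt1 c0 mun.
Qed.
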